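(* Let $\alpha^*$ be the optimal value of the linear program (in variables $\mu_r\ge 0$ for $r\in M$, $\nu^s_{ik}\ge0$ for $i\in N,k\in S_i$, $\nu^e_{ik}\ge 0$ for $i\in N,k\in E_i$, and free $y_{it},z_{it}$ for $i\in N,t\in T$) $$\begin{aligned}\min\quad & \sum_{r=1}^{m}\mu_r+\sum_{i=1}^{n}\sum_{k\in S_i}P^s_{ik}\nu^s_{ik}+\sum_{i=1}^{n}\sum_{k\in E_i}P^e_{ik}\nu^e_{ik}\\ \text{s.t.}\quad & y_{it}+z_{it}+\sum_{r=a_i}^{d_i}\mu_r\ge w_i,\quad \forall i\in N,\ t\in T,\\ & -y_{it}-\sum_{r=a_i}^{k-1}\mu_r+\nu^s_{ik}\ge 0,\quad\forall i\in N,\ t\in T,\ k\in S_i,\\ & -z_{it}-\sum_{r=k+1}^{d_i}\mu_r+\nu^e_{ik}\ge 0,\quad\forall i\in N,\ t\in T,\ k\in E_i. \end{aligned}$$ Let $\mu_{\mathrm{pes}}$ be an optimal solution of the linear program $\min\{\sum_{r=1}^m\mu_r:\ \sum_{r=a_i}^{d_i}\mu_r\ge w_i\ \forall i\in N,\ \mu\ge0\}$. Then $$\sum_{r=1}^m[\mu_{\mathrm{pes}}]_r\ \le\ \alpha^*\ \le\ \sum_{r=1}^m[\mu_{\mathrm{pes}}]_r\left(1+\sum_{i:\,a_i\le r\le b_i}(1-P^o_{ir})+\sum_{i:\,c_i\le r\le d_i}(1-P^o_{ir})\right).$$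
   Context: Slots $M=[m]=\{1,\dots,m\}$, tasks $N=[n]$, weights $w\in\mathbb{R}_+^N$, stages $T=[\min\{m,n\}]$. Each task $i\in N$ has independent random start time $s_i$ and end time $e_i$ in $M$ with discrete distributions having supports $S_i,E_i\subseteq M$, with $\max S_i\le\min E_i$. Put $a_i=\min S_i$, $b_i=\max S_i$, $c_i=\min E_i$, $d_i=\max E_i$. $P^s_{ik}=\Pr[s_i=k]$, $P^e_{ik}=\Pr[e_i=k]$, and $P^o_{ik}=\Pr[s_i\le k\le e_i]$ is the probability that task $i$ occupies slot $k$. Empty sums are $0$. *)

(* Defs.v *)
From HB Require Import structures.
From mathcomp Require Import all_boot all_order all_algebra.
From mathcomp Require Import all_classical all_reals all_analysis.
Set Implicit Arguments.
Unset Strict Implicit.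
Unset Printing Implicit Defensive.
Import Order.TTheory GRing.Theory Num.Theory.
Local Open Scope classical_set_scope.
Local Open Scope ring_scope.

Section Random.
Context {R : realType} {disp : measure_display} {Omega : measurableType disp}.
Context {P : probability Omega R}.

Definition indep {d1 d2} {T1 : measurableType d1} {T2 : measurableType d2}
    (X : {RV P >-> T1}) (Y : {RV P >-> T2}) : Prop :=
  forall (A : set T1) (B : set T2), measurable A -> measurable B ->
    P (X @^-1` A `&` Y @^-1` B) = (P (X @^-1` A) * P (Y @^-1` B))%E.

Definition prob (A : set Omega) : R := fine (P A).

(* Support of the distribution of a random variable with values in [1..m]. *)
Definition supp (m : nat) (X : {RV P >-> nat}) : seq nat :=
  [seq k <- index_iota 1 m.+1 | 0 < prob [set o | X o = k]].

End Random.

(* Least and greatest elements of a nonempty subset of [1..m]; the values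
   minS m [::] = m and maxS [::] = 0 play no role, supports being nonempty. *)
Definition minS (m : nat) (A : seq nat) : nat := \big[minn/m]_(k <- A) k.
Definition maxS (A : seq nat) : nat := \max_(k <- A) k.

Section LinearPrograms.
Context {R : realType} {V : Type}.
Variables (feasible : set V) (objective : V -> R).

Definition min_value : \bar R :=
  ereal_inf [set (objective x)%:E | x in feasible].

Definition optimal_solution (x : V) : Prop :=
  feasible x /\ forall x', feasible x' -> objective x <= objective x'.

End LinearPrograms.

Section Scheduling.
Context {R : realType} {disp : measure_display} {Omega : measurableType disp}.
Context {P : probability Omega R} {n : nat}.
Variables (m : nat) (w : 'I_n -> R) (s e : 'I_n -> {RV P >-> nat}).

Definition Ps (i : 'I_n) (k : nat) : R := prob (P := P) [set o | s i o = k].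
Definition Pe (i : 'I_n) (k : nat) : R := prob (P := P) [set o | e i o = k].
Definition Po (i : 'I_n) (k : nat) : R :=
  prob (P := P) [set o | (s i o <= k <= e i o)%N].

Definition S_ (i : 'I_n) : seq nat := supp m (s i).
Definition E_ (i : 'I_n) : seq nat := supp m (e i).

Definition a_ (i : 'I_n) : nat := minS m (S_ i).
Definition b_ (i : 'I_n) : nat := maxS (S_ i).
Definition c_ (i : 'I_n) : nat := minS m (E_ i).
Definition d_ (i : 'I_n) : nat := maxS (E_ i).

(* Only the components mu r with 1 <= r <= m, nus i k with k \in S_ i and
   nue i k with k \in E_ i are variables of the program; the others occur
   neither in the constraints nor in the objective. *)
Record lp_vars := LpVars {
  mu : nat -> R;
  nus : 'I_n -> nat -> R;
  nue : 'I_n -> nat -> R;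
  y : 'I_n -> 'I_(minn m n) -> R;
  z : 'I_n -> 'I_(minn m n) -> R }.

Definition lp_feasible (v : lp_vars) : Prop :=
  [/\ [/\ forall r, (1 <= r <= m)%N -> 0 <= mu v r,
          forall i k, k \in S_ i -> 0 <= nus v i k &
          forall i k, k \in E_ i -> 0 <= nue v i k],
      forall i t,
        y v i t + z v i t + \sum_(a_ i <= r < (d_ i).+1) mu v r >= w i,
      forall i t k, k \in S_ i ->
        - y v i t - \sum_(a_ i <= r < k) mu v r + nus v i k >= 0 &
      forall i t k, k \in E_ i ->
        - z v i t - \sum_(k.+1 <= r < (d_ i).+1) mu v r + nue v i k >= 0].

Definition lp_objective (v : lp_vars) : R :=
  \sum_(1 <= r < m.+1) mu v r
  + \sum_(i < n) \sum_(k <- S_ i) Ps i k * nus v i k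
  + \sum_(i < n) \sum_(k <- E_ i) Pe i k * nue v i k.

Definition alpha_star : \bar R := min_value lp_feasible lp_objective.

Definition pes_feasible (u : nat -> R) : Prop :=
  (forall r, (1 <= r <= m)%N -> 0 <= u r) /\
  forall i, \sum_(a_ i <= r < (d_ i).+1) u r >= w i.

Definition pes_objective (u : nat -> R) : R := \sum_(1 <= r < m.+1) u r.

End Scheduling.

(* Main.v *)
Require Import Defs.
From HB Require Import structures.
From mathcomp Require Import all_boot all_order all_algebra.
From mathcomp Require Import all_classical all_reals all_analysis.
Set Implicit Arguments.
Unset Strict Implicit.
Unset Printing Implicit Defensive.
Import Order.TTheory GRing.Theory Num.Theory.
Local Open Scope classical_set_scope.
Local Open Scope ring_scope.

(** The pessimistic program and the full one are compared through two maps.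
    Upper bound: mu_pes extends to a feasible point with y = z = 0 and with nus,
    nue equal to the partial sums of mu_pes they must dominate; since
    {s_i > r} and {e_i < r} are disjoint from {s_i <= r <= e_i}, both have
    probability at most 1 - P^o_ir, which bounds its objective.
    Lower bound: moving the expectation of nus + nue for task i onto
    the coordinate mu_(a_i) turns a feasible point into a feasible point of the
    pessimistic program with the same objective. *)

(** * Extremal elements of finite sets of slots *)

Lemma minS_ge (m lo : nat) (A : seq nat) :
  (lo <= m)%N -> (forall k, k \in A -> (lo <= k)%N) -> (lo <= minS m A)%N.
Proof.
(* The empty sequence takes the default value [m], which is where [lo <= m] enters. *)
move=> lo_m; rewrite /minS; elim: A => [|x A IH] loA; first by rewrite big_nil.
rewrite big_cons leq_min loA ?mem_head //=.
by apply: IH => k kA; apply: loA; rewrite in_cons kA orbT.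
Qed.

Lemma minS_le (m k : nat) (A : seq nat) : k \in A -> (minS m A <= k)%N.
Proof.
rewrite /minS; elim: A => // x A IH; rewrite in_cons big_cons geq_min.
by case/predU1P => [->|/IH ->]; rewrite ?leqnn ?orbT.
Qed.

Lemma le_maxS (k : nat) (A : seq nat) : k \in A -> (k <= maxS A)%N.
Proof. by move=> kA; exact: (leq_bigmax_seq (F := id) k). Qed.

Lemma maxS_le (hi : nat) (A : seq nat) :
  (forall k, k \in A -> (k <= hi)%N) -> (maxS A <= hi)%N.
Proof. by move=> Ahi; apply/bigmax_leqP_seq => k kA _; exact: Ahi. Qed.

(** * Distributions supported on the slots *)

Section Distribution.
Context {R : realType} {disp : measure_display} {Omega : measurableType disp}.
Context {P : probability Omega R}.

Lemma measurable_preimage_nat (X : {RV P >-> nat}) (A : set nat) :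
  measurable (X @^-1` A).
Proof. exact: (measurable_funPTI X). Qed.

Lemma prob_ge0 (A : set Omega) : 0 <= prob (P := P) A.
Proof. exact: fine_ge0. Qed.

Lemma prob_setT : prob (P := P) setT = 1.
Proof. by rewrite /prob probability_setT. Qed.

Lemma probU (A B : set Omega) : measurable A -> measurable B ->
  A `&` B = set0 -> prob (P := P) (A `|` B) = prob (P := P) A + prob (P := P) B.
Proof.
by move=> mA mB AB; rewrite /prob measureU// fineD// fin_num_measure.
Qed.

Lemma prob_disjoint_le (A B : set Omega) : measurable A -> measurable B ->
  A `&` B = set0 -> prob (P := P) A <= 1 - prob (P := P) B.
Proof.
move=> mA mB AB; rewrite lerBrDr -probU// -lee_fin /prob.
rewrite fineK ?fin_num_measure//.
  exact/probability_le1/measurableU.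
exact: measurableU.
Qed.

Lemma sum_prob_eq (X : {RV P >-> nat}) (A : seq nat) : uniq A ->
  \sum_(k <- A) prob (P := P) [set o | X o = k] =
  prob (P := P) [set o | X o \in A].
Proof.
elim: A => [_|x A IH /= /andP[xA uA]].
  rewrite big_nil (_ : [set o | _] = set0); last by apply/seteqP; split.
  by rewrite /prob measure0.
rewrite big_cons IH// -probU.
- congr prob; apply/seteqP; split => o /=; rewrite in_cons.
    by case=> [->|->]; rewrite ?eqxx ?orbT.
  by case/predU1P; [left|right].
- exact: (measurable_preimage_nat X [set x]).
- exact: (measurable_preimage_nat X [set` A]).
- by apply/seteqP; split => o //= [-> ]; exact/negP.
Qed.

Variables (m : nat) (X : {RV P >-> nat}).
Hypothesis X_in_M : forall o, (1 <= X o <= m)%N.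

Lemma mem_supp k : k \in supp m X -> (1 <= k <= m)%N.
Proof. by rewrite mem_filter mem_index_iota ltnS => /andP[]. Qed.

(** Slots outside the support carry probability 0, so the sum may run over all of [1..m], where [X]
    takes its values. *)
Lemma sum_prob_supp (Q : pred nat) :
  \sum_(k <- supp m X | Q k) prob (P := P) [set o | X o = k] =
  prob (P := P) [set o | Q (X o)].
Proof.
rewrite big_filter_cond big_mkcondl.
rewrite (eq_bigr (fun k => prob (P := P) [set o | X o = k])); last first.
  move=> k _; case: ifPn => //; rewrite -leNgt => pk.
  by apply/eqP; rewrite eq_le prob_ge0.
rewrite -big_filter sum_prob_eq ?filter_uniq ?iota_uniq//.
congr prob; apply/seteqP; split => o /=.
  by rewrite mem_filter => /andP[].
by rewrite mem_filter mem_index_iota ltnS X_in_M => ->.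
Qed.

Lemma sum_prob_supp1 : \sum_(k <- supp m X) prob (P := P) [set o | X o = k] = 1.
Proof.
rewrite (sum_prob_supp predT) -prob_setT; congr prob.
by apply/seteqP; split.
Qed.

(** An empty support would have total mass 0 instead of 1. *)
Lemma supp_nonempty : exists k, k \in supp m X.
Proof.
have := sum_prob_supp1; case: supp => [|k A _]; last first.
  by exists k; rewrite mem_head.
by rewrite big_nil => /eqP; rewrite eq_sym oner_eq0.
Qed.

Lemma minS_supp_gt0 : (0 < minS m (supp m X))%N.
Proof.
have [k kX] := supp_nonempty; apply: minS_ge => [|j /mem_supp/andP[]//].
by have /andP[k1 km] := mem_supp kX; exact: leq_trans k1 km.
Qed.

Lemma maxS_supp_le : (maxS (supp m X) <= m)%N.
Proof. by apply: maxS_le => k /mem_supp/andP[]. Qed.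

Lemma minS_le_maxS_supp : (minS m (supp m X) <= maxS (supp m X))%N.
Proof.
have [k kX] := supp_nonempty.
exact: (leq_trans (minS_le m kX) (le_maxS kX)).
Qed.

(** The weights sum to 1, so [c] is its own average. *)
Lemma le_expectation_supp (c : R) (f : nat -> R) :
  (forall k, k \in supp m X -> c <= f k) ->
  c <= \sum_(k <- supp m X) prob (P := P) [set o | X o = k] * f k.
Proof.
move=> cf; rewrite -[c]mul1r -sum_prob_supp1 mulr_suml !big_seq.
by apply: ler_sum => k kX; rewrite ler_wpM2l ?prob_ge0 ?cf.
Qed.

(** Moving the bounds into a condition over a fixed range allows the sum to be exchanged with
    another on which [lo] and [hi] depend. *)
Lemma sum_subinterval (lo hi : nat) (u : nat -> R) :
  (1 <= lo)%N -> (hi <= m.+1)%N ->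
  \sum_(lo <= r < hi) u r = \sum_(1 <= r < m.+1 | (lo <= r < hi)%N) u r.
Proof.
move=> lo1 him; rewrite (big_nat_widen _ _ m.+1)// (big_nat_widenl _ 1)//.
by apply: eq_bigl => r; rewrite andbC.
Qed.

(* Exchanging the sums, u r is weighted by the probability that r lies in the
   random interval [lo X, hi X[, an event disjoint from A r. *)
Lemma expectation_interval_sum_le (lo hi : nat -> nat) (u : nat -> R)
    (A : nat -> set Omega) (D : pred nat) :
  (forall r, (1 <= r <= m)%N -> 0 <= u r) ->
  (forall r, measurable (A r)) ->
  (forall k, k \in supp m X -> (1 <= lo k)%N && (hi k <= m.+1)%N) ->
  (forall k r, k \in supp m X -> (lo k <= r < hi k)%N -> D r) ->
  (forall r o, (lo (X o) <= r < hi (X o))%N -> ~ A r o) ->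
  \sum_(k <- supp m X)
     prob (P := P) [set o | X o = k] * \sum_(lo k <= r < hi k) u r <=
  \sum_(1 <= r < m.+1) u r * (if D r then 1 - prob (P := P) (A r) else 0).
Proof.
move=> u0 mA lohi inD disj.
have -> : \sum_(k <- supp m X)
    prob (P := P) [set o | X o = k] * \sum_(lo k <= r < hi k) u r =
  \sum_(1 <= r < m.+1) u r * \sum_(k <- supp m X | (lo k <= r < hi k)%N)
    prob (P := P) [set o | X o = k].
  rewrite big_seq.
  under eq_bigr => k kX.
    have /andP[? ?] := lohi _ kX.
    rewrite sum_subinterval// mulr_sumr big_mkcond/=; over.
  rewrite -big_seq exchange_big/=; apply: eq_bigr => r _.
  rewrite mulr_sumr [RHS]big_mkcond/=; apply: eq_bigr => k _.
  by case: ifP => // _; rewrite mulrC.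
rewrite !big_nat; apply: ler_sum => r rm; apply: ler_wpM2l; first exact: u0.
case: ifPn => [_|nDr].
  rewrite (sum_prob_supp (fun k => (lo k <= r < hi k)%N)).
  apply: prob_disjoint_le => //.
    exact: (measurable_preimage_nat X [set k | (lo k <= r < hi k)%N]).
  by apply/seteqP; split => o //= [/disj].
(* If [D r] fails, no interval attached to a support point contains [r], so the inner sum is
   empty. *)
rewrite big_seq_cond big1// => k /andP[kX kr].
by rewrite (inD _ _ kX kr) in nDr.
Qed.

End Distribution.

(** * Upper bound: extending a pessimistic solution *)

Section Bounds.
Context {R : realType} {disp : measure_display} {Omega : measurableType disp}.
Context {P : probability Omega R} {m n : nat}.
Variables (w : 'I_n -> R) (s e : 'I_n -> {RV P >-> nat}).
Hypothesis s_in_M : forall i o, (1 <= s i o <= m)%N.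
Hypothesis e_in_M : forall i o, (1 <= e i o <= m)%N.

Definition pes_extension (u : nat -> R) : lp_vars (R := R) (n := n) m :=
  LpVars u (fun i k => \sum_(a_ m s i <= r < k) u r)
           (fun i k => \sum_(k.+1 <= r < (d_ m e i).+1) u r)
           (fun=> fun=> 0) (fun=> fun=> 0).

Lemma pes_extension_feasible (u : nat -> R) :
  pes_feasible m w s e u ->
  lp_feasible w s e (pes_extension u).
Proof.
move=> [u0 uw]; split => /=.
- split=> // i k kX; rewrite big_nat;
    apply: sumr_ge0 => r /andP[lor rhi]; apply: u0.
    rewrite (leq_trans _ lor) ?minS_supp_gt0//=.
    by have /andP[_] := mem_supp kX; apply: leq_trans; exact: ltnW.
  rewrite (leq_trans _ lor)//=; rewrite ltnS in rhi.
  exact: leq_trans rhi (maxS_supp_le _ _).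
- by move=> i t; rewrite !add0r.
- by move=> i t k _; rewrite oppr0 add0r addNr.
- by move=> i t k _; rewrite oppr0 add0r addNr.
Qed.

Lemma measurable_occupied i r : measurable [set o | (s i o <= r <= e i o)%N].
Proof.
rewrite (_ : [set o | _] = s i @^-1` [set k | (k <= r)%N] `&`
  e i @^-1` [set k | (r <= k)%N]); last first.
  by apply/seteqP; split => o /=; [move/andP|move=> [-> ->]].
by apply: measurableI; exact: measurable_preimage_nat.
Qed.

Lemma pes_extension_objective (u : nat -> R) :
  (forall r, (1 <= r <= m)%N -> 0 <= u r) ->
  lp_objective s e (pes_extension u) <=
  \sum_(1 <= r < m.+1) u r *
    (1 + \sum_(i < n | (a_ m s i <= r <= b_ m s i)%N) (1 - Po s e i r)
       + \sum_(i < n | (c_ m e i <= r <= d_ m e i)%N) (1 - Po s e i r)).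
Proof.
have ifM (b : bool) r x :
    (if b then u r * x else 0) = u r * (if b then x else 0).
  by case: b; rewrite ?mulr0.
move=> u0; rewrite /lp_objective /=.
under [leRHS]eq_bigr do rewrite !mulrDr mulr1 !mulr_sumr.
rewrite !big_split/= -!addrA lerD2l; apply: lerD.
  under [leRHS]eq_bigr do rewrite big_mkcond/=.
  rewrite exchange_big/=; apply: ler_sum => i _.
  under [leRHS]eq_bigr do rewrite ifM.
  (* The random interval [a_i, s_i[ stays within [a_i, b_i], and its slots precede the start of the
     task. *)
  apply: (@expectation_interval_sum_le _ _ _ _ _ _ (s_in_M i)
    (fun=> a_ m s i) id) => //.
  - by move=> r; exact: measurable_occupied.
  - move=> k /mem_supp/andP[_ km]; rewrite minS_supp_gt0//=; exact: ltnW.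
  - move=> k r kX /andP[-> rk] /=; rewrite (leq_trans (ltnW rk))//.
    exact: le_maxS.
  - by move=> r o /andP[_ ro] /= /andP[]; rewrite leqNgt ro.
under [leRHS]eq_bigr do rewrite big_mkcond/=.
rewrite exchange_big/=; apply: ler_sum => i _.
under [leRHS]eq_bigr do rewrite ifM.
(* Symmetrically, ]e_i, d_i] lies within [c_i, d_i] and after the end of the task; [S] is the
   successor. *)
apply: (@expectation_interval_sum_le _ _ _ _ _ _ (e_in_M i)
  S (fun=> (d_ m e i).+1)) => //.
- by move=> r; exact: measurable_occupied.
- by move=> k _; rewrite /= ltnS maxS_supp_le.
- move=> k r kX /andP[kr]; rewrite ltnS => ->; rewrite andbT.
  by rewrite (leq_trans _ (ltnW kr))//; exact: minS_le.
- by move=> r o /andP[ro _] /= /andP[_]; rewrite leqNgt ro.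
Qed.

(** * Lower bound: shifting the expected duals onto the first possible slot *)

Hypothesis max_S_le_min_E : forall i, (b_ m s i <= c_ m e i)%N.

Lemma a_le_d i : (a_ m s i <= d_ m e i)%N.
Proof.
rewrite (leq_trans (minS_le_maxS_supp (s_in_M i)))//.
by rewrite (leq_trans (max_S_le_min_E i))// minS_le_maxS_supp.
Qed.

Definition expected_nu (v : lp_vars (R := R) (n := n) m) (i : 'I_n) : R :=
  \sum_(k <- S_ m s i) Ps s i k * nus v i k +
  \sum_(k <- E_ m e i) Pe e i k * nue v i k.

Lemma lp_objectiveE v :
  lp_objective s e v =
  \sum_(1 <= r < m.+1) mu v r + \sum_(i < n) expected_nu v i.
Proof. by rewrite /lp_objective -addrA -big_split. Qed.

Lemma expected_nu_ge0 v i : lp_feasible w s e v -> 0 <= expected_nu v i.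
Proof.
move=> [[_ nus0 nue0] _ _ _]; apply: addr_ge0; rewrite big_seq.
  by apply: sumr_ge0 => k kX; rewrite mulr_ge0 ?prob_ge0 ?nus0.
by apply: sumr_ge0 => k kX; rewrite mulr_ge0 ?prob_ge0 ?nue0.
Qed.

(* Averaging the constraints over the distributions of s i and e i bounds y
   and z by the expectations of nus and nue; any stage t serves. *)
Lemma weight_le_expected_nu v i : lp_feasible w s e v ->
  w i <= \sum_(a_ m s i <= r < (d_ m e i).+1) mu v r + expected_nu v i.
Proof.
move=> [[mu0 _ _] c1 c2 c3].
(* A stage exists: 1 <= a_i <= d_i <= m, and the task [i] itself shows that [n] is positive. *)
have minmn_gt0 : (0 < minn m n)%N.
  rewrite leq_min (leq_trans (minS_supp_gt0 (s_in_M i)))/=; last first.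
    exact: leq_trans (a_le_d i) (maxS_supp_le _ _).
  exact: leq_ltn_trans (ltn_ord i).
pose t := Ordinal minmn_gt0.
apply: (le_trans (c1 i t)); rewrite addrC lerD2l; apply: lerD.
  apply: le_expectation_supp => // k kX; have := c2 i t k kX.
  (* The constraint reads y + (partial sum of mu) <= nus; dropping the nonnegative partial sum
     leaves y <= nus. *)
  rewrite addrC -opprD subr_ge0; apply: le_trans; rewrite lerDl big_nat.
  apply: sumr_ge0 => r /andP[lor rk]; apply: mu0.
  rewrite (leq_trans _ lor) ?minS_supp_gt0//=.
  by have /andP[_] := mem_supp kX; apply: leq_trans; exact: ltnW.
apply: le_expectation_supp => // k kX; have := c3 i t k kX.
rewrite addrC -opprD subr_ge0; apply: le_trans; rewrite lerDl big_nat.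
apply: sumr_ge0 => r /andP[lor rhi]; apply: mu0.
rewrite (leq_trans _ lor)//=; rewrite ltnS in rhi.
exact: leq_trans rhi (maxS_supp_le _ _).
Qed.

Definition shifted_mu (v : lp_vars (R := R) (n := n) m) (r : nat) : R :=
  mu v r + \sum_(i < n | a_ m s i == r) expected_nu v i.

Lemma shifted_mu_feasible v :
  lp_feasible w s e v -> pes_feasible m w s e (shifted_mu v).
Proof.
move=> vf; have [[mu0 _ _] _ _ _] := vf; split=> [r rm|i].
  by rewrite addr_ge0 ?mu0 ?sumr_ge0// => i _; exact: expected_nu_ge0.
apply: (le_trans (weight_le_expected_nu i vf)); rewrite big_split/= lerD2l.
(* Since a_i <= d_i, the interval of task [i] contains slot a_i, which received [expected_nu v i];
   all other added terms are nonnegative. *)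
rewrite [leRHS]big_ltn ?ltnS ?a_le_d// (bigD1 i)//= -addrA lerDl.
rewrite addr_ge0 ?sumr_ge0// => [j _|r _]; first exact: expected_nu_ge0.
by apply: sumr_ge0 => j _; exact: expected_nu_ge0.
Qed.

(** Each a_i lies in [1..m], so the sum over slots counts every [expected_nu v i] exactly once. *)
Lemma shifted_mu_objective v :
  pes_objective m (shifted_mu v) = lp_objective s e v.
Proof.
rewrite lp_objectiveE /pes_objective big_split/=; congr (_ + _).
under eq_bigr do rewrite big_mkcond/=.
rewrite exchange_big/=; apply: eq_bigr => i _.
under eq_bigr do rewrite eq_sym.
rewrite -big_mkcond/= big_nat1_eq minS_supp_gt0//= ltnS.
by rewrite (leq_trans (minS_le_maxS_supp (s_in_M i)) (maxS_supp_le _ _)).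
Qed.

End Bounds.

Theorem mainTheorem4 (R : realType) (disp : measure_display)
    (Omega : measurableType disp) (P : probability Omega R) (m n : nat)
    (w : 'I_n -> R) (s e : 'I_n -> {RV P >-> nat})
    (w_ge0 : forall i, 0 <= w i)
    (s_in_M : forall i o, (1 <= s i o <= m)%N)
    (e_in_M : forall i o, (1 <= e i o <= m)%N)
    (se_indep : forall i, indep (s i) (e i))
    (max_S_le_min_E : forall i, (b_ m s i <= c_ m e i)%N)
    (mu_pes : nat -> R)
    (mu_pes_opt :
      optimal_solution (pes_feasible m w s e) (pes_objective m) mu_pes) :
  ((\sum_(1 <= r < m.+1) mu_pes r)%:E <= alpha_star m w s e)%E /\
  (alpha_star m w s e <=
    (\sum_(1 <= r < m.+1) mu_pes r *
      (1 + \sum_(i < n | (a_ m s i <= r <= b_ m s i)%N) (1 - Po s e i r)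
         + \sum_(i < n | (c_ m e i <= r <= d_ m e i)%N) (1 - Po s e i r)))%:E)%E.
Proof.
have [pes_f pes_min] := mu_pes_opt; split.
  apply: le_ereal_inf_tmp => _ [v vf <-]; rewrite lee_fin.
  rewrite -(shifted_mu_objective e s_in_M).
  exact/pes_min/(shifted_mu_feasible s_in_M e_in_M max_S_le_min_E).
apply: le_trans (ereal_inf_lbound _) _.
  by eexists; [exact: (pes_extension_feasible s_in_M pes_f)|reflexivity].
by rewrite lee_fin; apply: (pes_extension_objective s_in_M e_in_M); case: pes_f.
Qed.
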